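(* Let $n\ge 7$ be an integer. Every connected graph $G$ of order $n$ and size at most $2n$ has a foresty minimum vertex cut. Moreover, the bound is best possible: for every integer $n\ge 7$ there exists a connected graph of order $n$ and size $2n+1$ which has no foresty minimum vertex cut.
   Context: All graphs are finite and simple. The order of a graph is its number of vertices and the size is its number of edges. A vertex cut of a connected graph $G$ is a set $S\subset V(G)$ such that $G-S$ is disconnected. If $G$ has connectivity $k$, a vertex cut $S$ is called minimum if $|S|=k$. A vertex cut $S$ is called a foresty vertex cut if the induced subgraph $G[S]$ is a forest (acyclic). *)

(* Defs.v *)
From mathcomp Require Import all_boot.
Set Implicit Arguments. Unset Strict Implicit. Unset Printing Implicit Defensive.

(* A finite simple graph: vertex type T : finType, adjacency e : rel T,
   assumed symmetric and irreflexive (hypotheses stated in the theorem). *)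

Definition edge_set (T : finType) (e : rel T) : {set {set T}} :=
  [set E : {set T} | [exists x, exists y, e x y && (E == [set x; y])]].

Definition gsize (T : finType) (e : rel T) : nat := #|edge_set e|.

Definition gconnected (T : finType) (e : rel T) : Prop :=
  forall x y : T, connect e x y.

Definition del_rel (T : finType) (e : rel T) (S : {set T}) : rel T :=
  fun x y => [&& e x y, x \notin S & y \notin S].

Definition vertex_cut (T : finType) (e : rel T) (S : {set T}) : Prop :=
  exists x y : T, [/\ x \notin S, y \notin S & ~~ connect (del_rel e S) x y].

Definition min_vertex_cut (T : finType) (e : rel T) (S : {set T}) : Prop :=
  vertex_cut e S /\ forall S' : {set T}, vertex_cut e S' -> #|S| <= #|S'|.

Definition has_cycle_in (T : finType) (e : rel T) (S : {set T}) : Prop :=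
  exists p : seq T, [/\ 3 <= size p, uniq p, all (fun v => v \in S) p & cycle e p].

Definition induced_forest (T : finType) (e : rel T) (S : {set T}) : Prop :=
  ~ has_cycle_in e S.

Definition foresty_min_vertex_cut (T : finType) (e : rel T) (S : {set T}) : Prop :=
  min_vertex_cut e S /\ induced_forest e S.

(* Main.v *)
(** A graph with at most [2n] edges has a vertex of degree at most 4, so the
    connectivity [k] is at most 4, and only [k = 3] and [k = 4] need an argument.

    Suppose no minimum cut is foresty. If [k = 3], every 3-cut is a triangle. The
    neighborhood of a vertex of degree 3 is then a clique, so deleting that vertex
    preserves the hypotheses while removing 3 edges; by induction there is room for
    no such vertex, and the graph is 4-regular. Each vertex of a triangular cut
    [{a, b, c}] then has exactly one neighbor on each side; if [a'] is the one of
    [a] on a given side, [{a', b, c}] is again a cut, hence a triangle, and [a']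
    alone is a cut. If [k = 4], the graph is 4-regular and all neighborhoods are
    4-cuts. A [K4] on [v, a, b, c] gives the foresty cut consisting of [v], [a] and
    the outer neighbors of [b] and [c]; without [K4], all neighborhoods are induced
    4-cycles and the graph is the octahedron, of order 6.

    For sharpness, take the square of the cycle of order [n - 1], which is
    4-connected, and join a new vertex to three consecutive vertices: the only
    minimum cut is that triangle. *)

Require Import Defs.
From mathcomp Require Import all_boot zify.
From Stdlib Require Import Classical.
Set Implicit Arguments. Unset Strict Implicit. Unset Printing Implicit Defensive.

(** * Degrees and separations inside a vertex subset *)

Definition neighbors (T : finType) (e : rel T) (x : T) : {set T} := [set y | e x y].

Definition degree_in (T : finType) (e : rel T) (U : {set T}) (x : T) : nat :=
  #|[set y in U | e x y]|.

(** [A] is a union of components of the graph induced on [U] minus [S], and some vertex is left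
    over. Working relative to [U] allows vertices to be deleted without changing the type. *)
Definition separates (T : finType) (e : rel T) (U A S : {set T}) : Prop :=
  [/\ S \subset U, A \subset U :\: S, A != set0, ~~ (U \subset A :|: S) &
      forall x y, x \in A -> y \in U -> e x y -> y \in A :|: S].

Definition clique (T : finType) (e : rel T) (S : {set T}) : Prop :=
  forall x y, x \in S -> y \in S -> x != y -> e x y.

Section Separation.
Variables (T : finType) (e : rel T).
Hypotheses (e_sym : symmetric e) (e_irr : irreflexive e).

Lemma adj_neq x y : e x y -> x != y.
Proof. by apply: contraTneq => ->; rewrite e_irr. Qed.

Lemma handshake : \sum_x #|neighbors e x| = 2 * gsize e.
Proof.
have deg_edges x : #|neighbors e x| = \sum_(E in edge_set e) (x \in E).
  (* Sending [y] to [[set x; y]] is a bijection from the neighbors of [x] to the edges through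
     [x]. *)
  rewrite -(@card_in_imset _ _ (fun y => [set x; y])); last first.
    move=> y z; rewrite !inE => xy xz /setP/(_ y).
    rewrite !inE eqxx orbT => /esym/orP[/eqP yx|/eqP //].
    by rewrite yx e_irr in xy.
  rewrite -sum1_card -[RHS]big_mkcondr; apply: eq_bigl => E.
  apply/imsetP/andP => [[y]|[]].
    rewrite inE => xy ->; split; last by rewrite !inE eqxx.
    by rewrite inE; apply/existsP; exists x; apply/existsP; exists y; rewrite xy eqxx.
  rewrite inE => /existsP[a /existsP[b /andP[ab /eqP ->]]].
  rewrite !inE => /orP[] /eqP ->; first by exists b; rewrite ?inE.
  by exists a; rewrite ?inE 1?e_sym // setUC.
rewrite (eq_bigr _ (fun x _ => deg_edges x)) exchange_big /=.
rewrite (eq_bigr (fun=> 2)); first by rewrite sum_nat_const mulnC.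
move=> E; rewrite inE => /existsP[a /existsP[b /andP[ab /eqP ->]]].
by rewrite -big_mkcond sum1_card cards2 (adj_neq ab).
Qed.

Lemma vertex_cutP S : vertex_cut e S <-> exists A, separates e setT A S.
Proof.
split=> [[x [y [xS yS nxy]]]|[A [_ AS A0 Sx Acl]]].
  (* The component of [x] once [S] is deleted. *)
  exists [set z | connect (del_rel e S) x z && (z \notin S)]; split.
  - exact: subsetT.
  - by apply/subsetP => z; rewrite !inE => /andP[_ ->].
  - by apply/set0Pn; exists x; rewrite inE connect0.
  - by apply/subsetPn; exists y; rewrite ?inE // (negbTE yS) (negbTE nxy).
  - move=> u w; rewrite !inE => /andP[xu uS] _ uw.
    case wS: (w \in S); rewrite ?orbT //= orbF andbT.
    by apply: connect_trans xu (connect1 _); rewrite /del_rel uw uS wS.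
have [x xA] := set0Pn _ A0; have [y _ yAS] := subsetPn Sx.
have := subsetP AS _ xA; rewrite !inE andbT => xS.
move: yAS; rewrite !inE negb_or => /andP[yA yS].
exists x, y; split=> //; apply: contra yA.
have cl : closed (del_rel e S) (mem A).
  move=> u w /and3P[uw uS wS]; apply/idP/idP => [uA|wA].
    by have := Acl u w uA (in_setT _) uw; rewrite inE (negbTE wS) orbF.
  by have := Acl w u wA (in_setT _); rewrite e_sym => /(_ uw); rewrite inE (negbTE uS) orbF.
by move/(closed_connect cl) => <-.
Qed.

Lemma vertex_cut_of_closed (A S : {set T}) :
  [disjoint A & S] -> A != set0 -> #|A :|: S| < #|T| ->
  (forall x y, x \in A -> e x y -> y \in A :|: S) -> vertex_cut e S.
Proof.
move=> dAS A0 AST Acl; apply/vertex_cutP; exists A; split=> //.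
- by apply/subsetP => x xA; rewrite !inE andbT (disjointFr dAS xA).
- by apply: contraL AST => /subset_leq_card; rewrite cardsT -leqNgt.
- by move=> x y xA _; apply: Acl.
Qed.

(** * Peeling off vertices of degree three *)

Section Peel.
Variable U : {set T}.
Hypothesis U_cut : forall A S, separates e U A S -> 3 <= #|S| /\ (#|S| = 3 -> clique e S).

Lemma separates_neighbors x : x \in U -> (degree_in e U x).+1 < #|U| ->
  separates e U [set x] [set y in U | e x y].
Proof.
move=> xU dU; split.
- by apply/subsetP => y; rewrite inE => /andP[].
- by rewrite sub1set !inE xU e_irr.
- by apply/set0Pn; exists x; rewrite inE.
- apply: contraL dU => /subset_leq_card; rewrite cardsU1 inE e_irr andbF.
  by rewrite -leqNgt.
- by move=> u y; rewrite !inE => /eqP -> -> ->; rewrite orbT.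
Qed.

Lemma degree_ge3 x : 4 <= #|U| -> x \in U -> 3 <= degree_in e U x.
Proof.
move=> U4 xU; rewrite leqNgt; apply/negP => d2.
have [|S3 _] := U_cut (separates_neighbors xU _); first by lia.
by move: S3; rewrite leqNgt d2.
Qed.

Lemma clique_neighbors x : 5 <= #|U| -> x \in U -> degree_in e U x = 3 ->
  clique e [set y in U | e x y].
Proof.
move=> U5 xU d3; have [|_] := U_cut (separates_neighbors xU _); first by lia.
exact.
Qed.

(** A clique cannot meet both sides of a separation, so [x] can be put back on a side containing all
    its neighbors outside [S]. *)
Lemma separates_peel x A S : clique e [set y in U | e x y] -> x \in U ->
  separates e (U :\ x) A S -> exists A', separates e U A' S.
Proof.
move=> cl xU [SU AU A0 UAS Acl].
have xS : x \notin S by apply/negP => /(subsetP SU); rewrite !inE eqxx.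
have SU' : S \subset U by apply: subset_trans SU (subsetDl _ _).
have AU' : A \subset U :\: S.
  by apply/subsetP => y /(subsetP AU); rewrite !inE => /and3P[-> _ ->].
have [z] := subsetPn UAS; rewrite !inE negb_or => /andP[zx zU] /andP[zA zS].
case: (set_0Vmem [set c in A | e x c]) => [none|[c]].
  exists A; split=> //.
    by apply/subsetPn; exists z; rewrite ?inE // negb_or zA.
  move=> u y uA yU uy; case: (eqVneq y x) => [yx|yx].
    by move/setP/(_ u): none; rewrite !inE uA e_sym -yx uy.
  by apply: Acl uA _ uy; rewrite !inE yx.
rewrite inE => /andP[cA xc].
(* [x] joins the side of its neighbor [c]: any other neighbor of [x] is adjacent to [c], hence lies
   in [A] or [S]. *)
exists (x |: A); split=> //.
- by apply/subsetP => y; rewrite !inE => /orP[/eqP ->|/(subsetP AU')]; rewrite ?xS ?xU ?inE.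
- by apply/set0Pn; exists x; rewrite !inE eqxx.
- by apply/subsetPn; exists z; rewrite ?inE // (negbTE zx) (negbTE zA).
move=> u y; rewrite !inE => /orP[/eqP ->|uA] yU uy.
  case: (eqVneq y x) => // yx /=; case: (eqVneq y c) => [->|yc]; first by rewrite cA.
  have cU : c \in U by have := subsetP AU' _ cA; rewrite inE => /andP[].
  have cy : e c y by apply: cl; rewrite ?inE ?cU ?yU ?xc // eq_sym.
  by have := Acl c y cA; rewrite !inE yx yU => /(_ isT cy).
case: (eqVneq y x) => //= yx.
by have := Acl u y uA; rewrite !inE yx yU => /(_ isT uy).
Qed.

(** Deleting [x] loses its own degree and one from each of its neighbors. *)
Lemma sum_degree_peel x : x \in U ->
  \sum_(y in U) degree_in e U y =
  \sum_(y in U :\ x) degree_in e (U :\ x) y + 2 * degree_in e U x.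
Proof.
move=> xU; rewrite (big_setD1 x) //= mul2n -addnn addnCA; congr addn.
have -> : degree_in e U x = \sum_(y in U :\ x) (e x y).
  rewrite -big_mkcondr /= /degree_in -sum1_card; apply: eq_bigl => y.
  by rewrite !inE; case: eqP => // ->; rewrite e_irr andbF.
rewrite -big_split /=; apply: eq_bigr => y; rewrite !inE => /andP[yx yU].
rewrite /degree_in (cardsD1 x) inE xU e_sym addnC; congr (_ + _).
by apply: eq_card => z; rewrite !inE andbA.
Qed.

End Peel.

(** The degree sum is at least 12, 18, 24 for 4, 5, 6 vertices and at least [4 * #|U|] from then on.
    Peeling a vertex of degree 3 accounts for 6; if there is none, all degrees are at least 4. The
    cap [minn _ 2] keeps the bound below what the second case gives. *)
Lemma sum_degree_lower_bound (U : {set T}) :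
  (forall A S, separates e U A S -> 3 <= #|S| /\ (#|S| = 3 -> clique e S)) ->
  4 <= #|U| -> 4 * #|U| + 2 * minn (#|U| - 4) 2 <= \sum_(x in U) degree_in e U x + 4.
Proof.
move: {2}#|U| (leqnn #|U|) => k; elim: k U => [|k IH] U; first by lia.
move=> Uk Ucut U4.
have bound d : (forall x, x \in U -> d <= degree_in e U x) ->
    d * #|U| <= \sum_(x in U) degree_in e U x.
  by move=> h; rewrite mulnC -sum_nat_const; apply: leq_sum.
have deg3 := degree_ge3 Ucut U4.
case: (leqP #|U| 4) => U5; first by have := bound 3 deg3; lia.
case: (boolP [exists x in U, degree_in e U x == 3]) => [|/exists_inPn no3].
  case/exists_inP => x xU /eqP d3.
  have cl := clique_neighbors Ucut U5 xU d3.
  have cU : #|U| = #|U :\ x|.+1 by rewrite (cardsD1 x) xU.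
  have cut' A S : separates e (U :\ x) A S -> 3 <= #|S| /\ (#|S| = 3 -> clique e S).
    by move/(separates_peel cl xU) => [A' /Ucut].
  have k' : #|U :\ x| <= k by lia.
  have U4' : 4 <= #|U :\ x| by lia.
  by have := IH _ k' cut' U4'; rewrite (sum_degree_peel xU) d3; lia.
have := bound 4; have h : forall x, x \in U -> 4 <= degree_in e U x.
  by move=> x xU; rewrite ltn_neqAle eq_sym no3 // deg3.
by move/(_ h); lia.
Qed.

End Separation.

(** * Cycles in small sets and criteria for vertex cuts *)

Section MinimumCuts.
Variables (T : finType) (e : rel T).
Hypotheses (e_sym : symmetric e) (e_irr : irreflexive e).

(** Two consecutive edges of the cycle; this is enough to exclude cycles in a set inducing a
    matching. *)
Lemma cycle_two_neighbors (S : {set T}) : has_cycle_in e S ->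
  exists x y z, [/\ [/\ x \in S, y \in S & z \in S], y != z, e x y & e x z].
Proof.
move=> [[|a [|b [|c p]]] []] //= _ /and3P[aN bN _] /and4P[aS bS cS _] /andP[ab /andP[bc _]].
exists b, a, c; split=> //; last by rewrite e_sym.
by apply: contra aN => /eqP ->; rewrite !inE eqxx orbT.
Qed.

Lemma cycle_card (S : {set T}) : has_cycle_in e S -> 3 <= #|S|.
Proof.
move=> [p [p3 pU /allP pS _]]; apply: leq_trans p3 _.
by rewrite cardE uniq_leq_size // => x /pS; rewrite mem_enum.
Qed.

Lemma cycle3_clique (S : {set T}) : has_cycle_in e S -> #|S| = 3 -> clique e S.
Proof.
move=> [p [p3 pU /allP pS pC]] S3.
have [] := uniq_min_size pU (s2 := enum S).
- by move=> x /pS; rewrite mem_enum.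
- by rewrite -cardE S3.
rewrite -cardE S3; case: p p3 pU pS pC => [|a [|b [|c [|]]]] //= _ _ _.
rewrite andbT => /and3P[ab bc ca] _ pS x y.
rewrite -![_ \in S]mem_enum -!pS !inE.
by do 2![case/or3P=> /eqP ->]; rewrite ?eqxx // => _; rewrite // e_sym.
Qed.

(** A cycle in a set of four vertices has length 3 or passes through all of them. *)
Lemma cycle4_cases (S : {set T}) : has_cycle_in e S -> #|S| = 4 ->
  (exists x y z, [/\ [/\ x \in S, y \in S & z \in S], e x y, e y z & e z x]) \/
  (exists a b c d, [/\ S =i [:: a; b; c; d], uniq [:: a; b; c; d] &
     [/\ e a b, e b c, e c d & e d a]]).
Proof.
move=> [p [p3 pU /allP pS pC]] S4.
case: (ltnP (size p) 4) => p4.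
  left; case: p p3 pU pS pC p4 => [|a [|b [|c [|]]]] //= _ _ pS.
  rewrite andbT => /and3P[ab bc ca] _; exists a, b, c; split=> //.
  by split; apply: pS; rewrite !inE eqxx ?orbT.
right; have [] := uniq_min_size pU (s2 := enum S).
- by move=> x /pS; rewrite mem_enum.
- by rewrite -cardE S4.
rewrite -cardE S4; case: p p3 p4 pU pS pC => [|a [|b [|c [|d [|]]]]] //= _ _ pU _.
rewrite andbT => /and4P[ab bc cd da] _ pS; exists a, b, c, d; split=> //.
by move=> x; rewrite -mem_enum pS.
Qed.

Lemma neighbors_eq x s : #|neighbors e x| = size s -> uniq s -> all (e x) s ->
  forall y, e x y = (y \in s).
Proof.
move=> dx us /allP xs y.
have [] := uniq_min_size us (s2 := enum (neighbors e x)).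
- by move=> z /xs xz; rewrite mem_enum inE.
- by rewrite -cardE dx.
by move=> _ ->; rewrite mem_enum inE.
Qed.

Lemma vertex_cut_seq (s t : seq T) z :
  s != [::] -> z \notin s ++ t -> ~~ has (mem t) s ->
  (forall x y, x \in s -> e x y -> y \in s ++ t) ->
  vertex_cut e [set x in t].
Proof.
move=> s0 zst dis cl; apply/(vertex_cutP e_sym); exists [set x in s]; split=> //.
- apply/subsetP => x; rewrite !inE andbT => xs.
  by apply: contra dis => xt; apply/hasP; exists x.
- case: s s0 {zst dis cl} => // x s _; apply/set0Pn; exists x.
  by rewrite !inE eqxx.
- by apply/subsetPn; exists z; rewrite ?inE // -mem_cat.
- by move=> x y; rewrite !inE -mem_cat => xs _; apply: cl.
Qed.

Lemma exists_notin (s : seq T) : size s < #|T| -> exists z, z \notin s.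
Proof.
move=> sT; have /subsetPn[z _ zs] : ~~ ([set: T] \subset [set x in s]).
  apply: contraL sT => /subset_leq_card; rewrite cardsT cardsE -leqNgt => sT.
  exact: leq_trans sT (card_size s).
by exists z; rewrite inE in zs.
Qed.

Lemma card_seq_set (t : seq T) : #|[set x in t]| <= size t.
Proof. by rewrite cardsE card_size. Qed.

Lemma vertex_cut_neighbors v : #|neighbors e v|.+1 < #|T| -> vertex_cut e (neighbors e v).
Proof.
move=> dv; apply: (@vertex_cut_of_closed _ _ e_sym [set v]).
- by rewrite disjoints1 inE e_irr.
- by apply/set0Pn; exists v; rewrite inE.
- by rewrite cardsU1; case: (_ \notin _); lia.
- by move=> x y; rewrite !inE => /eqP -> ->; rewrite orbT.
Qed.

Section Regular.
Hypothesis reg4 : forall x, #|neighbors e x| = 4.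

Lemma neighbors4 x a b c d : uniq [:: a; b; c; d] -> e x a -> e x b -> e x c -> e x d ->
  forall y, e x y = (y \in [:: a; b; c; d]).
Proof. by move=> u xa xb xc xd; apply: neighbors_eq; rewrite /= ?reg4 ?xa ?xb ?xc ?xd. Qed.

(** * Four-regular graphs whose 3-cuts are triangles *)

Section Connectivity3.
Hypothesis cut3 : forall S, vertex_cut e S -> 3 <= #|S| /\ (#|S| = 3 -> clique e S).

(** Otherwise [S :\ s] would still separate [A], with only two vertices. *)
Lemma minimal_cut_neighbor A S s : separates e setT A S -> #|S| = 3 -> s \in S ->
  exists2 y, y \in A & e s y.
Proof.
move=> [_ AS A0 SA Acl] S3 sS; apply/exists_inP; apply: contraT => /exists_inPn no.
have /cut3[] : vertex_cut e (S :\ s).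
  apply/(vertex_cutP e_sym); exists A; split=> //.
  - by apply/subsetP => x xA; have := subsetP AS _ xA; rewrite !inE !andbT negb_and => ->; rewrite orbT.
  - by apply: contra SA => /subset_trans; apply; apply: setUS; apply: subsetDl.
  - move=> x y xA yT xy; have := Acl x y xA yT xy; rewrite !inE.
    by case: (eqVneq y s) => // ys; have := no x xA; rewrite -ys e_sym xy.
by have := cardsD1 s S; rewrite sS; lia.
Qed.

Lemma separates_compl A S : separates e setT A S -> separates e setT (~: (A :|: S)) S.
Proof.
move=> [_ AS A0 SA Acl]; split=> //.
- by apply/subsetP => x; rewrite !inE negb_or => /andP[_ ->].
- by have [x _ xAS] := subsetPn SA; apply/set0Pn; exists x; rewrite inE.
- have [x xA] := set0Pn _ A0; apply/subsetPn; exists x; rewrite ?inE //.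
  by have := subsetP AS _ xA; rewrite !inE xA andbT.
- move=> x y; rewrite !inE negb_or => /andP[xA xS] _ xy.
  case: (boolP (y \in S)) => yS; rewrite ?orbT //= !orbF.
  apply/negP => yA; have := Acl y x yA (in_setT _); rewrite e_sym => /(_ xy).
  by rewrite inE (negbTE xA) (negbTE xS).
Qed.

Lemma no_cut3 S : vertex_cut e S -> #|S| = 3 -> False.
Proof.
move=> cS S3; have [_ /(_ S3) cl] := cut3 cS.
have [A sAS] := (vertex_cutP e_sym S).1 cS.
have [_ AS A0 SA Acl] := sAS.
(* Of the four neighbors of [s], two lie in the triangle [S] and at least one on the far side, so at
   most one lies in [A]. *)
have uniqA s x y : s \in S -> x \in A -> y \in A -> e s x -> e s y -> x = y.
  move=> sS xA yA sx sy; apply/eqP; apply: contraT => xy.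
  have [z zB sz] := minimal_cut_neighbor (separates_compl sAS) S3 sS.
  have : z |: (x |: (y |: (S :\ s))) \subset neighbors e s.
    apply/subsetP => u; rewrite !inE => /or4P[/eqP->|/eqP->|/eqP->|/andP[us uS]] //.
    by apply: cl; rewrite // eq_sym.
  have notS u : u \in A -> u \notin S.
    by move=> /(subsetP AS); rewrite !inE andbT.
  move/subset_leq_card; rewrite reg4 !cardsU1 !inE.
  have := cardsD1 s S; rewrite sS S3 => SD.
  move: zB; rewrite !inE negb_or => /andP[zA zS].
  have -> : (z == x) = false by apply: contraNF zA => /eqP ->.
  have -> : (z == y) = false by apply: contraNF zA => /eqP ->.
  by rewrite (negbTE zS) (negbTE (notS _ xA)) (negbTE (notS _ yA)) (negbTE xy) !andbF; clear -SD; lia.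
have [a aS] : exists a, a \in S by apply/set0Pn; rewrite -card_gt0 S3.
have [a' a'A aa'] := minimal_cut_neighbor sAS S3 aS.
have a'S : a' \notin S by have := subsetP AS _ a'A; rewrite !inE andbT.
(* If [A] were just [a'], its four neighbors would all lie in the 3-set [S]. *)
have A'0 : A :\ a' != set0.
  apply/negP => /eqP A'0.
  have : neighbors e a' \subset S.
    apply/subsetP => y; rewrite inE => a'y.
    have := Acl _ _ a'A (in_setT y) a'y; rewrite inE => /orP[yA|//].
    have : y \in A :\ a' by rewrite !inE yA eq_sym (adj_neq e_irr a'y).
    by rewrite A'0 inE.
  by move/subset_leq_card; rewrite reg4 S3.
have aA : a \notin A by apply/negP => /(subsetP AS); rewrite !inE aS.
(* Trading [a] for [a'] still separates the rest of [A], since [a'] is the only neighbor of [a]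
   there. *)
have cS' : vertex_cut e (a' |: (S :\ a)).
  apply/(vertex_cutP e_sym); exists (A :\ a'); split=> //.
  - apply/subsetP => x; rewrite !inE andbT negb_or => /andP[-> xA] /=.
    by have := subsetP AS _ xA; rewrite !inE andbT negb_and => ->; rewrite orbT.
  - apply/subsetPn; exists a; rewrite // !inE eqxx (negbTE aA) andbF /= orbF.
    by apply: adj_neq e_irr _ _ aa'.
  - move=> x y; rewrite !inE => /andP[xa' xA] _ xy.
    have := Acl x y xA (in_setT y) xy; rewrite !inE.
    case: (eqVneq y a') => //= ya'; case: (eqVneq y a) => //= ya.
    by case/negP: xa'; apply/eqP; apply: (uniqA a); rewrite // e_sym -ya.
have S'3 : #|a' |: (S :\ a)| = 3.
  by rewrite cardsU1 !inE (negbTE a'S) andbF -S3 (cardsD1 a S) aS.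
have [_ /(_ S'3) cl'] := cut3 cS'.
(* The new cut is a triangle too, so [a'] is the unique neighbor in [A] of every vertex of [S], and
   the rest of [A] is attached to [a'] alone. *)
have /cut3[] : vertex_cut e [set a'].
  apply/(vertex_cutP e_sym); exists (A :\ a'); split=> //.
  - by apply/subsetP => x; rewrite !inE andbT => /andP[-> _].
  - apply/subsetPn; exists a; rewrite // !inE (negbTE aA) andbF /=.
    by apply: adj_neq e_irr _ _ aa'.
  - move=> x y; rewrite !inE => /andP[xa' xA] _ xy.
    have := Acl x y xA (in_setT y) xy; rewrite !inE.
    case: (eqVneq y a') => //= ya' /orP[-> //|yS].
    case/negP: xa'; apply/eqP; apply: (uniqA y); rewrite // 1?e_sym //.
    case: (eqVneq y a) => [->|ya]; first by rewrite e_sym.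
    by apply: cl'; rewrite ?inE ?eqxx ?ya ?yS ?orbT // eq_sym.
by rewrite cards1.
Qed.

End Connectivity3.

(** * Four-regular graphs whose 4-cuts contain cycles *)

Section Connectivity4.
Hypothesis n7 : 7 <= #|T|.
Hypothesis cut4 : forall S, vertex_cut e S -> 4 <= #|S| /\ (#|S| = 4 -> has_cycle_in e S).

Lemma clique4_outer_neighbor (K : {set T}) : clique e K -> #|K| = 4 ->
  (* Three neighbors of [x] lie in [K], so exactly one lies outside; the default of [odflt] is never
     reached. *)
  exists q : T -> T, forall x, x \in K ->
    q x \notin K /\ forall y, y \notin K -> e x y = (y == q x).
Proof.
move=> cl K4; exists (fun x => odflt x [pick y in neighbors e x :\: K]) => x xK.
have /eqP/cards1P[y Ny] : #|neighbors e x :\: K| = 1.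
  have NK : neighbors e x :&: K = K :\ x.
    apply/setP => y; rewrite !inE; case: (boolP (y \in K)) => yK; rewrite ?andbF // !andbT.
    by apply/idP/idP => [xy|yx]; [rewrite eq_sym (adj_neq e_irr) | rewrite cl // eq_sym].
  have := cardsID K (neighbors e x); rewrite NK reg4.
  by have := cardsD1 x K; rewrite xK K4; lia.
rewrite Ny; case: pickP => [z|/(_ y)]; rewrite !inE ?eqxx // => /eqP -> /=.
have := set11 y; rewrite -Ny !inE => /andP[yK xy]; split=> // u uK.
by move/setP/(_ u): Ny; rewrite !inE uK.
Qed.

Section K4.
Variables (K : {set T}) (q : T -> T).
Hypotheses (K4 : #|K| = 4) (qK : forall x, x \in K -> q x \notin K)
  (Kq : forall x y, x \in K -> y \notin K -> e x y = (y == q x)).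

(** If two outer neighbors coincide, the set [X] of outer neighbors has at most three vertices. It
    is too small to be a cut, so [K] and [X] cover the graph; then [q b] has at most three
    neighbors, namely [b] and the rest of [X]. *)
Lemma outer_neighbor_inj : {in K &, injective q}.
Proof.
move=> v a vK aK qva; apply/eqP; apply: contraT => va.
have : #|K :\ v :\ a| == 2.
  by have := cardsD1 v K; have := cardsD1 a (K :\ v); rewrite !inE vK aK eq_sym va; lia.
case/cards2P => b [c [bc Kbc]].
have inK x : (x \in K) = (x \in [:: v; a; b; c]).
  move/setP/(_ x): Kbc; rewrite !inE => <-.
  case: (eqVneq x v) => [-> //|]; case: (eqVneq x a) => [-> //|] //.
have bK : b \in K by rewrite inK !inE eqxx !orbT.
have cK : c \in K by rewrite inK !inE eqxx !orbT.
pose X := [set x in [:: q v; q b; q c]].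
have qX x : x \in K -> q x \in X.
  by rewrite inK !inE => /or4P[] /eqP ->; rewrite -?qva eqxx ?orbT.
have cl x y : x \in K -> e x y -> y \in K :|: X.
  move=> xK xy; case: (boolP (y \in K)) => yK; rewrite inE ?yK // orbC.
  by move: xy; rewrite Kq // => /eqP ->; rewrite qX.
have X3 : #|X| <= 3 by apply: card_seq_set.
have KX0 : [disjoint K & X].
  rewrite disjoint_sym disjoint_subset; apply/subsetP => x; rewrite !inE.
  by case/or3P => /eqP ->; apply: qK.
have KX : #|K :|: X| = 4 + #|X| by rewrite cardsU disjoint_setI0 // cards0 subn0 K4.
case: (ltnP #|K :|: X| #|T|) => [KXT|TKX].
  have /cut4[] : vertex_cut e X.
    apply: (vertex_cut_of_closed e_sym KX0) => //.
    by rewrite -card_gt0 K4.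
  by lia.
have {}X3 : #|X| = 3 by lia.
have KXT y : y \in K :|: X.
  have /eqP -> : K :|: X == setT by rewrite eqEcard subsetT cardsT.
  by rewrite inE.
have uX : uniq [:: q v; q b; q c] by apply/card_uniqP; rewrite -cardsE.
have /subset_leq_card : neighbors e (q b) \subset b |: (X :\ q b).
  apply/subsetP => y; rewrite inE => qby.
  have yqb : y != q b by rewrite eq_sym (adj_neq e_irr).
  have := KXT y; rewrite !in_setU !in_setD1 yqb /=.
  case: (boolP (y \in K)) => [yK _|_ /= ->]; last by rewrite orbT.
  move: qby; rewrite e_sym Kq ?qK // => /eqP qby; apply/orP; left.
  move: yK uX; rewrite inK /= !inE; case: (eqVneq y b) => // _.
  by case/or4P => /eqP // yE; move: qby; rewrite yE -?qva => ->; rewrite ?eqxx ?orbT ?andbF.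
rewrite reg4 cardsU1; have := cardsD1 (q b) X; rewrite X3 qX //.
by clear; case: (b \notin _) => /=; lia.
Qed.

End K4.

Lemma no_clique4 (K : {set T}) : clique e K -> #|K| <> 4.
Proof.
move=> cl K4; have [q qP] := clique4_outer_neighbor cl K4.
have qK x : x \in K -> q x \notin K by case/qP.
have Kq x y : x \in K -> y \notin K -> e x y = (y == q x) by case/qP => _; apply.
have inj := outer_neighbor_inj K4 qK Kq.
have /set0Pn[v vK] : K != set0 by rewrite -card_gt0 K4.
have /set0Pn[a] : K :\ v != set0.
  by rewrite -card_gt0; have := cardsD1 v K; rewrite vK; lia.
rewrite !inE => /andP[av aK].
have : #|K :\ v :\ a| == 2.
  by have := cardsD1 v K; have := cardsD1 a (K :\ v); rewrite !inE vK aK av; lia.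
case/cards2P => b [c [bc Kbc]].
have inK x : (x \in K) = (x \in [:: v; a; b; c]).
  move/setP/(_ x): Kbc; rewrite !inE => <-.
  case: (eqVneq x v) => [-> //|]; case: (eqVneq x a) => [-> //|] //.
have : b \in K :\ v :\ a by rewrite Kbc !inE eqxx.
have : c \in K :\ v :\ a by rewrite Kbc !inE eqxx orbT.
rewrite !inE => /and3P[ca cv cK] /and3P[ba bv bK].
(* This set cuts off [b] and [c]. By injectivity of [q], the only edges it can induce are [v a] and
   [q b] to [q c], so it contains no cycle. *)
pose S := [set x in [:: v; a; q b; q c]].
have cS : vertex_cut e S.
  apply: (@vertex_cut_of_closed _ _ e_sym [set x in [:: b; c]]).
  - rewrite disjoint_subset; apply/subsetP => x; rewrite !inE.
    have neq y z : y \in K -> z \in K -> (y == q z) = false.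
      by move=> yK zK; apply: contraTF yK => /eqP ->; apply: qK.
    by case/orP => /eqP ->; rewrite !negb_or !neq ?bK ?cK ?bv ?ba ?cv ?ca.
  - by apply/set0Pn; exists b; rewrite !inE eqxx.
  (* The cut and its small side use at most six of the at least seven vertices. *)
  - apply: leq_ltn_trans n7.
    apply: leq_trans (card_seq_set [:: b; c; v; a; q b; q c]).
    by apply: subset_leq_card; apply/subsetP => x; rewrite !inE -orbA.
  - move=> x y; rewrite !inE => xbc xy.
    have xK : x \in K by rewrite inK !inE; case/orP: xbc => ->; rewrite !orbT.
    case: (boolP (y \in K)); last first.
      move=> yK; move: xy; rewrite Kq // => /eqP ->.
      by case/orP: xbc => /eqP ->; rewrite eqxx !orbT.
    by rewrite inK !inE => /or4P[] ->; rewrite ?orbT.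
have [S4] := cut4 cS; have S4' := card_seq_set [:: v; a; q b; q c].
case/(_ (anti_leq (introT andP (conj S4' S4)))) /cycle_two_neighbors => x [y [z [[xS yS zS] yz xy xz]]].
have no u w : u \in K -> w \in K -> u != w -> e u (q w) = false.
  by move=> uK wK uw; rewrite Kq ?qK //; apply: contraNF uw => /eqP/inj ->.
have [vb vc] : v != b /\ v != c by split; rewrite eq_sym.
have [ab ac] : a != b /\ a != c by split; rewrite eq_sym.
have N := (no _ _ vK bK vb, no _ _ vK cK vc, no _ _ aK bK ab, no _ _ aK cK ac).
have N' := (e_sym (q b) v, e_sym (q b) a, e_sym (q c) v, e_sym (q c) a).
move: xS yS zS; rewrite !inE => /or4P[] /eqP xE /or4P[] /eqP yE /or4P[] /eqP zE;
  by move: yz xy xz; rewrite xE yE zE ?eqxx ?e_irr ?N' ?N.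
Qed.

Lemma no_triangle_in_neighbors v x y z :
  e v x -> e v y -> e v z -> e x y -> e y z -> e z x -> False.
Proof.
move=> vx vy vz xy yz zx; apply: (@no_clique4 [set t in [:: v; x; y; z]]).
  move=> s t; rewrite !inE.
  by do 2![case/or4P=> /eqP ->]; rewrite ?eqxx // => _; rewrite // e_sym.
rewrite cardsE; apply/card_uniqP; rewrite /= !inE !negb_or.
by rewrite !(adj_neq e_irr) // e_sym.
Qed.

(** The neighborhood is itself a 4-cut and so contains a cycle. A triangle, or a chord of a 4-cycle,
    would complete a [K4] with [v]. *)
Lemma neighbors_square v : exists a b c d,
  [/\ (forall y, e v y = (y \in [:: a; b; c; d])), uniq [:: a; b; c; d],
     [/\ e a b, e b c, e c d & e d a] & e a c = false /\ e b d = false].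
Proof.
have cN : vertex_cut e (neighbors e v) by apply: vertex_cut_neighbors; rewrite reg4; lia.
have [_ /(_ (reg4 v)) cyc] := cut4 cN.
have [[x [y [z [[]]]]]|[a [b [c [d [N u [ab bc cd da]]]]]]] := cycle4_cases cyc (reg4 v).
  by rewrite !inE => vx vy vz xy yz zx; case: (no_triangle_in_neighbors vx vy vz xy yz zx).
have Nv y : e v y = (y \in [:: a; b; c; d]) by rewrite -N inE.
have [va vb vc vd] : [/\ e v a, e v b, e v c & e v d].
  by split; rewrite Nv !inE eqxx ?orbT.
exists a, b, c, d; split=> //; split; apply/negP => h.
  by apply: (no_triangle_in_neighbors va vb vc) => //; rewrite e_sym.
by apply: (no_triangle_in_neighbors vb vc vd) => //; rewrite e_sym.
Qed.

Lemma opposite_neighbor v p : e v p ->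
  exists2 r, e v r & r != p /\ e p r = false.
Proof.
have [a [b [c [d [N u _ [ac bd]]]]]] := neighbors_square v.
move: u; rewrite /= !inE !negb_or => /and4P[/and3P[ab ac' ad] /andP[bc bd'] cd _].
rewrite N !inE => /or4P[] /eqP ->.
- by exists c; rewrite ?N ?inE ?eqxx ?orbT // eq_sym.
- by exists d; rewrite ?N ?inE ?eqxx ?orbT // eq_sym.
- by exists a; rewrite ?N ?inE ?eqxx ?orbT // e_sym.
- by exists b; rewrite ?N ?inE ?eqxx ?orbT // e_sym.
Qed.

(** [p] and [r] are opposite corners of the square around [v], and every other corner is adjacent to
    both. *)
Lemma nonadjacent_neighbors v p r t : e v p -> e v r -> e v t ->
  p != r -> e p r = false -> t != p -> t != r -> e r t.
Proof.
have [a [b [c [d [N u [ab bc cd da] _]]]]] := neighbors_square v.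
have [ba cb dc ad] : [/\ e b a, e c b, e d c & e a d] by split; rewrite e_sym.
by rewrite !N !inE; do 3![case/or4P=> /eqP ->]; rewrite ?eqxx ?ab ?bc ?cd ?da ?ba ?cb ?dc ?ad.
Qed.

(* The closed set of six vertices found here is the octahedron. *)
Lemma no_cut4_regular : False.
Proof.
have /card_gt0P[v _] : 0 < #|T| by lia.
have [a [b [c [d [Nv u [ab bc cd da] _]]]]] := neighbors_square v.
have [va vb vc vd] : [/\ e v a, e v b, e v c & e v d].
  by split; rewrite Nv !inE eqxx ?orbT.
have av : e a v by rewrite e_sym.
(* [w] is opposite to [v] in the square around [a]; it will be the second pole of the octahedron. *)
have [w aw [wv vw]] := opposite_neighbor av.
have far x : e v x -> x != w by move=> vx; apply: contraTneq vx => ->; rewrite vw.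
(* In the square around [x] the corners [v] and [w] are opposite, so a further corner [y] is
   adjacent to [w]. *)
have step x y : e x v -> e x w -> e x y -> y != v -> e v y -> e w y.
  move=> xv xw xy yv vy; apply: (nonadjacent_neighbors xv xw xy) => //; last exact: far.
  by rewrite eq_sym.
have neq x : e v x -> x != v by move=> vx; rewrite eq_sym (adj_neq e_irr).
have wb : e w b by apply: (step a) => //; apply: neq.
have wd : e w d by apply: (step a); rewrite // 1?e_sym //; apply: neq.
have wc : e w c by apply: (step b); rewrite // 1?e_sym //; apply: neq.
have wa : e w a by rewrite e_sym.
move: (u); rewrite /= !inE !negb_or => /and4P[/and3P[ab' ac' ad'] /andP[bc' bd'] cd' _].
have N x p r : e v x -> e w x -> e v p -> e v r -> e x p -> e x r -> p != r ->
    forall y, e x y = (y \in [:: v; w; p; r]).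
  move=> vx wx vp vr xp xr pr; apply: neighbors4; rewrite 1?[e x v]e_sym 1?[e x w]e_sym //.
  rewrite /= !inE !negb_or pr (adj_neq e_irr vp) (adj_neq e_irr vr) eq_sym wv.
  by rewrite ![w == _]eq_sym !far.
have Nw : forall y, e w y = (y \in [:: a; b; c; d]) by apply: neighbors4.
have [z zN] : exists z, z \notin [:: v; w; a; b; c; d] by apply: exists_notin.
(* No edge leaves the six vertices and [z] lies outside them, so even the empty set is a cut. *)
have /cut4[] : vertex_cut e [set x in [::]].
  apply: (@vertex_cut_seq [:: v; w; a; b; c; d] _ z) => //.
  have [ba cb dc ad] : [/\ e b a, e c b, e d c & e a d] by split; rewrite e_sym.
  move=> x y; rewrite cats0 !inE => /or4P[/eqP->|/eqP->|/eqP->|/or3P[]/eqP->].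
  - by rewrite Nv !inE => /or4P[] ->; rewrite ?orbT.
  - by rewrite Nw !inE => /or4P[] ->; rewrite ?orbT.
  - by rewrite (N a b d) // !inE => /or4P[] ->; rewrite ?orbT.
  - by rewrite (N b a c) // !inE => /or4P[] ->; rewrite ?orbT.
  - by rewrite (N c b d) // !inE => /or4P[] ->; rewrite ?orbT.
  - by rewrite (N d a c) // !inE => /or4P[] ->; rewrite ?orbT.
by move=> /leq_trans/(_ (card_seq_set [::])).
Qed.

End Connectivity4.
End Regular.

(** * Existence of a foresty minimum cut for size at most [2n] *)

Lemma exists_min_vertex_cut S : vertex_cut e S -> exists S', min_vertex_cut e S'.
Proof.
have [k] := ubnP #|S|; elim: k S => // k IH S Sk cS.
case: (classic (exists2 S', vertex_cut e S' & #|S'| < #|S|)) => [[S' cS' S'S]|min].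
  by apply: (IH S') => //; lia.
exists S; split=> // S' cS'; rewrite leqNgt; apply/negP => S'S.
by apply: min; exists S'.
Qed.

Lemma degree_inT x : degree_in e setT x = #|neighbors e x|.
Proof. by apply: eq_card => y; rewrite !inE. Qed.

Lemma foresty_min_vertex_cut_exists : 7 <= #|T| ->
  gsize e <= 2 * #|T| -> exists S, foresty_min_vertex_cut e S.
Proof.
move=> n7 sz; apply: NNPP => none.
have hasC S : min_vertex_cut e S -> has_cycle_in e S.
  by move=> mS; apply: NNPP => nC; apply: none; exists S.
have sumd := handshake e_sym e_irr.
(* The degree sum is at most [4 * #|T|], so minimum degree 4 leaves no slack. *)
have regular : (forall x, 4 <= #|neighbors e x|) -> forall x, #|neighbors e x| = 4.
  move=> d4 x; apply/eqP; rewrite eqn_leq d4 andbT leqNgt; apply/negP => d5.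
  have : \sum_(i | i != x) 4 <= \sum_(i | i != x) #|neighbors e i| by apply: leq_sum.
  by move: sumd; rewrite (bigD1 x) //= sum_nat_const cardC1; lia.
have [x0 dx0] : exists x, #|neighbors e x| <= 4.
  apply: NNPP => no; suff : #|T| * 5 <= 2 * gsize e by lia.
  rewrite -sumd -sum_nat_const; apply: leq_sum => x _.
  by rewrite ltnNge; apply/negP => dx; apply: no; exists x.
have cutN x : #|neighbors e x| <= 4 -> vertex_cut e (neighbors e x).
  by move=> dx; apply: vertex_cut_neighbors; lia.
have [S0 mS0] := exists_min_vertex_cut (cutN _ dx0).
have [cS0 min0] := mS0; have S04 := leq_trans (min0 _ (cutN _ dx0)) dx0.
have S03 := cycle_card (hasC _ mS0).
have cutC S : vertex_cut e S -> #|S| = #|S0| -> has_cycle_in e S.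
  by move=> cS SS0; apply: hasC; split=> // S' /min0; rewrite SS0.
case: (ltnP #|S0| 4) => S0k; last first.
  have {S0k}S0k : #|S0| = 4 by lia.
  apply: (@no_cut4_regular _ n7).
    apply: regular => x; rewrite leqNgt; apply/negP => dx.
    by have := min0 _ (cutN x (ltnW dx)); lia.
  by move=> S cS; split=> [|S4]; [rewrite -S0k min0 | apply: cutC; rewrite ?S0k].
have {S0k}S0k : #|S0| = 3 by lia.
have cut3 S : vertex_cut e S -> 3 <= #|S| /\ (#|S| = 3 -> clique e S).
  move=> cS; split=> [|S3]; first by rewrite -S0k min0.
  by apply: cycle3_clique => //; apply: cutC; rewrite ?S0k.
have cutT A S : separates e setT A S -> 3 <= #|S| /\ (#|S| = 3 -> clique e S).
  by move=> sAS; apply: cut3; apply/(vertex_cutP e_sym); exists A.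
have [x /eqP dx|no3] := pickP (fun x => #|neighbors e x| == 3); last first.
  apply: (no_cut3 _ cut3 cS0 S0k); apply: regular => x; rewrite ltn_neqAle eq_sym no3.
  by rewrite -degree_inT (degree_ge3 e_irr cutT) ?inE // cardsT; lia.
have xT := in_setT x.
have T5 : 5 <= #|[set: T]| by rewrite cardsT; lia.
have cl : clique e [set y in setT | e x y].
  by apply: (clique_neighbors e_irr cutT) => //; rewrite degree_inT.
have cut' A S : separates e (setT :\ x) A S -> 3 <= #|S| /\ (#|S| = 3 -> clique e S).
  by move/(separates_peel e_sym cl xT) => [A' /cutT].
have Tx : #|T| = #|[set: T] :\ x|.+1 by rewrite -cardsT (cardsD1 x) xT.
(* At least six vertices remain without [x], so their degree sum is at least [4 * (#|T| - 1)];
   restoring [x] adds 6 and exceeds [4 * #|T|]. *)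
have low := sum_degree_lower_bound e_sym e_irr cut'.
have := sum_degree_peel e_sym e_irr xT; rewrite degree_inT dx.
have -> : \sum_(y in setT) degree_in e setT y = 2 * gsize e.
  by rewrite -sumd; apply: eq_big => [y|y _]; rewrite ?inE ?degree_inT.
clear -low Tx sz n7; lia.
Qed.

End MinimumCuts.

(** * Sharpness: the capped square of a cycle *)

(** A forward step of length 1 or 2 modulo [N]; the wrap-around is written additively to stay within
    linear arithmetic. *)
Definition cycle_square_arc (N i j : nat) : bool :=
  [&& i < N, j < N & [|| j == i + 1, j == i + 2, j + N == i + 1 | j + N == i + 2]].

(* Square of the cycle on [0 .. N - 1], with the extra vertex [N] joined to [0, 1, 2]. *)
Definition capped_cycle_square (N i j : nat) : bool :=
  [|| cycle_square_arc N i j, cycle_square_arc N j i,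
      (i == N) && (j < 3) | (j == N) && (i < 3)].

(** Climb from [a] to [N.-1], wrap around to 0, then climb to [b]. *)
Lemma cyclic_ind (N a : nat) (Q : nat -> Prop) :
  a < N -> Q a -> (forall k, k.+1 < N -> Q k -> Q k.+1) -> (Q N.-1 -> Q 0) ->
  forall b, b < N -> Q b.
Proof.
move=> aN Qa step wrap.
have up k l : Q k -> k <= l -> l < N -> Q l.
  move=> Qk; elim: l => [|l IH] kl lN; first by move: kl; rewrite leqn0 => /eqP <-.
  case: (eqVneq k l.+1) => [<- //|kl']; apply: step => //; apply: IH; lia.
move=> b bN; apply: (up 0) => //; apply: wrap; apply: (up a) => //; lia.
Qed.

Lemma card_ord_mem n (L : seq nat) : uniq L -> all (fun i => i < n) L ->
  #|[set y : 'I_n | (y : nat) \in L]| = size L.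
Proof.
move=> uL /allP Ln; rewrite cardsE cardE -(size_map val).
apply/perm_size/uniq_perm => //; first by rewrite map_inj_uniq ?enum_uniq //; apply: val_inj.
move=> i; apply/mapP/idP => [[y]|iL]; first by rewrite mem_enum => yL ->.
by exists (Ordinal (Ln _ iL)); rewrite ?mem_enum.
Qed.

Lemma card_ord_lt3 n : 3 <= n -> #|[set x : 'I_n | x < 3]| = 3.
Proof.
move=> n3; rewrite -[RHS](@card_ord_mem n [:: 0; 1; 2]) //=; last by lia.
by apply: eq_card => y; rewrite !inE; lia.
Qed.

Section CappedCycleSquare.
Variable N : nat.
Hypothesis N6 : 6 <= N.
Let e : rel 'I_N.+1 := fun x y => capped_cycle_square N x y.

Lemma capped_sym : symmetric e.
Proof. by move=> x y; rewrite /e /capped_cycle_square; lia. Qed.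

Lemma capped_irr : irreflexive e.
Proof. by move=> x; rewrite /e /capped_cycle_square /cycle_square_arc; lia. Qed.

Lemma capped_degree (x : 'I_N.+1) :
  #|neighbors e x| = if x == N :> nat then 3 else 4 + (x < 3).
Proof.
have xN := ltn_ord x.
(* Addition modulo [N] for [k] at most [N]; thus [up (N - 1)] and [up (N - 2)] are backward
   steps. *)
pose up k := if x + k < N then x + k else x + k - N.
have [xE|xE] := eqVneq (x : nat) N.
  rewrite -[RHS](@card_ord_mem N.+1 [:: 0; 1; 2]) //=; last by lia.
  apply: eq_card => y; have := ltn_ord y; rewrite !inE /e /capped_cycle_square /cycle_square_arc /=; lia.
pose L := [:: up 1; up 2; up (N - 1); up (N - 2)].
have L4 (y : 'I_N.+1) : y < N -> e x y = ((y : nat) \in L).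
  rewrite !inE /e /capped_cycle_square /cycle_square_arc /up /=; by do !case: ifP => ? //; lia.
have LN : all (fun i => i < N) L by rewrite /= /up; do !case: ifP => ?; lia.
have uL : uniq L by rewrite /= !inE /up; do !case: ifP => ?; lia.
have LN1 : all (fun i => i < N.+1) L by apply: sub_all LN => i; lia.
case: (ltnP x 3) => x3.
  rewrite -[RHS](@card_ord_mem N.+1 (N :: L)); last first.
  - by rewrite /= in LN1 *; rewrite LN1 leqnn.
  - rewrite /= in uL *; rewrite uL andbT; apply/negP => /(allP LN); by rewrite ltnn.
  apply: eq_card => y; rewrite [in LHS]inE [in RHS]inE in_cons.
  have := ltn_ord y; rewrite ltnS leq_eqVlt => /orP[/eqP yN|yN]; last first.
    by rewrite L4 // (ltn_eqF yN).
  by rewrite yN eqxx /e /capped_cycle_square yN x3 eqxx !orbT.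
rewrite -[RHS](@card_ord_mem N.+1 L) //; apply: eq_card => y; rewrite [in LHS]inE [in RHS]inE.
have := ltn_ord y; rewrite ltnS leq_eqVlt => /orP[/eqP yN|yN]; last exact: L4.
have /negbTE NL : N \notin L by apply/negP => /(allP LN); rewrite ltnn.
rewrite yN NL /e /capped_cycle_square /cycle_square_arc yN; lia.
Qed.

(** The degree sum is [4 * N + 3 + 3]: four per cycle vertex, one more for each of 0, 1, 2, and
    three for the cap. *)
Lemma capped_size : gsize e = 2 * N.+1 + 1.
Proof.
have := handshake capped_sym capped_irr.
rewrite (eq_bigr _ (fun x _ => capped_degree x)) big_ord_recr /= eqxx.
rewrite (eq_bigr (fun i : 'I_N => 4 + (i < 3))); last first.
  by move=> i _; rewrite (ltn_eqF (ltn_ord i)).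
rewrite big_split /= sum_nat_const card_ord.
have -> : \sum_(i < N) (i < 3) = 3.
  have N3 : 3 <= N by lia.
  by rewrite -big_mkcond sum1_card -[RHS](card_ord_lt3 N3); apply: eq_card => y; rewrite inE.
by lia.
Qed.

(** The successor along the cycle. The cap [N] is also sent to 0, so injectivity holds only on cycle
    vertices. *)
Let u (x : 'I_N.+1) : 'I_N.+1 := inord (if x.+1 < N then x.+1 else 0).

Let u_val x : (u x : nat) = if x.+1 < N then x.+1 else 0.
Proof. by rewrite /u inordK //; case: ifP => ? //; lia. Qed.

Let u_lt x : u x < N.
Proof. by rewrite u_val; case: ifP => ?; lia. Qed.

Let u_inj (x y : 'I_N.+1) : x < N -> y < N -> u x = u y -> x = y.
Proof.
move=> xN yN /(congr1 (@nat_of_ord _)); rewrite !u_val.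
by do 2![case: ifP => ?] => ?; apply: val_inj => /=; lia.
Qed.

Let u_neq_id (x : 'I_N.+1) : u x != x.
Proof.
apply/eqP => /(congr1 (@nat_of_ord _)); rewrite u_val.
by case: ifP => ?; have := ltn_ord x; lia.
Qed.

Let u_adj (x : 'I_N.+1) : x < N -> e x (u x).
Proof.
rewrite /e /capped_cycle_square /cycle_square_arc u_val.
by case: ifP => ? ?; lia.
Qed.

Let uu_adj (x : 'I_N.+1) : x < N -> e x (u (u x)).
Proof.
move=> xN; have := u_val x; rewrite /e /capped_cycle_square /cycle_square_arc (u_val (u x)).
by do 2![case: ifP => ?] => ?; lia.
Qed.

(* Leaving [A] along the cycle crosses two consecutive vertices of [S]; doing so
   from both sides of a separation forces four vertices in [S]. *)
Lemma capped_gap (A S : {set 'I_N.+1}) (a b : 'I_N.+1) :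
  separates e setT A S -> a \in A -> a < N -> b \notin A :|: S -> b < N ->
  exists i : 'I_N.+1, [/\ i < N, i \in A, u i \in S & u (u i) \in S].
Proof.
move=> [_ _ _ _ Acl] aA aN bAS bN; apply: NNPP => no.
have next i : i \in A -> i < N -> (u i \in A) || (u (u i) \in A).
  move=> iA iN; apply: contraT; rewrite negb_or => /andP[uA uuA]; case: no; exists i.
  have := Acl i (u i) iA (in_setT _) (u_adj iN).
  have := Acl i (u (u i)) iA (in_setT _) (uu_adj iN).
  by rewrite !inE (negbTE uA) (negbTE uuA).
(* Without a gap of two, meeting [A] at [k] or its successor propagates around the whole cycle and
   reaches [b]. *)
pose Q k := (inord k \in A) || (u (inord k) \in A).
have Qu k : k < N -> Q k -> Q (u (inord k)).
  move=> kN; rewrite /Q inord_val => /orP[kA|->] //.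
  by apply: next => //; rewrite inordK //; lia.
have Qb : Q b.
  apply: (@cyclic_ind N a Q) => //; first by rewrite /Q inord_val aA.
    by move=> k kN /Qu; rewrite u_val inordK ?kN; [apply; lia|lia].
  by move/Qu; rewrite u_val inordK; [rewrite prednK ?ltnn; [apply; lia|lia]|lia].
(* [b] lies outside [A], so its successor is in [A]; being adjacent to it, [b] would lie in [A] or
   [S]. *)
move: Qb; rewrite /Q inord_val => /orP[bA|ubA]; first by rewrite inE bA in bAS.
have := Acl (u b) b ubA (in_setT _); rewrite capped_sym u_adj // => /(_ isT).
by rewrite (negbTE bAS).
Qed.

Lemma capped_small_cut (S : {set 'I_N.+1}) : vertex_cut e S -> #|S| <= 3 ->
  S = [set x : 'I_N.+1 | x < 3].
Proof.
move=> /(vertex_cutP capped_sym)[A sA] S3.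
have T3 : #|[set x : 'I_N.+1 | x < 3]| = 3 by apply: card_ord_lt3; lia.
(* A side consisting of the cap alone forces its three neighbors into [S], which has no room for
   more. *)
have alone B : separates e setT B S -> (forall x, x \in B -> N <= x) ->
    S = [set x : 'I_N.+1 | x < 3].
  move=> [_ BS B0 _ Bcl] BN; apply/eqP; rewrite eq_sym eqEcard T3 S3 andbT.
  have [x xB] := set0Pn _ B0; apply/subsetP => y; rewrite inE => y3.
  have xN : x = N :> nat by have := BN x xB; have := ltn_ord x; lia.
  have := Bcl x y xB (in_setT _); rewrite /e /capped_cycle_square xN eqxx y3 !orbT.
  by move=> /(_ isT); rewrite inE => /orP[/BN|//]; lia.
have sB := separates_compl capped_sym sA; set B := ~: (A :|: S) in sB.
have [a /andP[aA aN]|noA] := pickP (fun a : 'I_N.+1 => (a \in A) && (a < N)); last first.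
  by apply: alone sA _ => x xA; rewrite leqNgt; have := noA x; rewrite xA /= => ->.
have [b /andP[bB bN]|noB] := pickP (fun b : 'I_N.+1 => (b \in B) && (b < N)); last first.
  by apply: alone sB _ => x xB; rewrite leqNgt; have := noB x; rewrite xB /= => ->.
have [_ AS _ _ _] := sA.
have disjA x : x \in A -> x \notin S by move/(subsetP AS); rewrite !inE andbT.
have [i [iN iA uiS uuiS]] : exists i : 'I_N.+1, [/\ i < N, i \in A, u i \in S & u (u i) \in S].
  by apply: (capped_gap sA aA aN _ bN); rewrite -in_setC.
have [j [jN jB ujS uujS]] : exists i : 'I_N.+1, [/\ i < N, i \in B, u i \in S & u (u i) \in S].
  apply: (capped_gap sB bB bN _ aN); rewrite !inE aA /=; exact: disjA.
(* [i] and [j] lie on opposite sides while their successors lie in [S]; injectivity of [u] then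
   makes the four vertices distinct. *)
have : uniq [:: u i; u (u i); u j; u (u j)].
  have u_neq (x y : 'I_N.+1) : x < N -> y < N -> x != y -> u x != u y.
    by move=> xN yN; apply: contra_neq; apply: u_inj.
  move: jB; rewrite !inE negb_or => /andP[jA jS].
  have iS := disjA _ iA.
  have ij : i != j by apply: contraNneq jA => <-.
  have iuj : i != u j by apply: contraNneq iS => ->.
  have uij : u i != j by apply: contraNneq jS => <-.
  rewrite /= !inE !negb_or !u_neq ?u_lt // eq_sym u_neq_id // eq_sym u_neq_id //.

move=> uq; have : 4 <= #|S|; last by rewrite leqNgt ltnS S3.
rewrite cardE; apply: (uniq_leq_size uq) => x; rewrite !inE mem_enum.
by case/or4P => /eqP ->.
Qed.

Lemma capped_cut3 : vertex_cut e [set x : 'I_N.+1 | x < 3].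
Proof.
apply: (@vertex_cut_of_closed _ _ capped_sym [set ord_max]).
- by rewrite disjoints1 inE -leqNgt /=; lia.
- by apply/set0Pn; exists ord_max; rewrite inE.
- have N3 : 3 <= N.+1 by lia.
  by rewrite cardsU1 (card_ord_lt3 N3) card_ord; case: (_ \notin _); lia.
- move=> x y; rewrite !inE => /eqP ->; rewrite -val_eqE /= /e /capped_cycle_square /cycle_square_arc /=.
  by lia.
Qed.

(** In a disconnected graph the empty set would be a cut, but the only cut of at most three vertices
    is the triangle. *)
Lemma capped_connected : gconnected e.
Proof.
move=> x y; apply: contraT => nxy.
have /capped_small_cut : vertex_cut e set0.
  exists x, y; rewrite !inE; split=> //; apply: contra nxy.
  by rewrite (@eq_connect _ _ e) // => i j; rewrite /del_rel !inE !andbT.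
rewrite cards0 => /(_ isT)/(congr1 (fun A => #|pred_of_set A|)).
by rewrite cards0 card_ord_lt3; lia.
Qed.

Lemma capped_no_foresty S : ~ foresty_min_vertex_cut e S.
Proof.
move=> [[cS minS] forest].
have S3 : #|S| <= 3 by have := minS _ capped_cut3; rewrite card_ord_lt3; lia.
apply: forest; rewrite (capped_small_cut cS S3).
have k_lt k : k < 3 -> k < N.+1 by lia.
exists [:: Ordinal (k_lt 0 isT); Ordinal (k_lt 1 isT); Ordinal (k_lt 2 isT)].
split=> //; rewrite /= ?inE //.
by rewrite /e /capped_cycle_square /cycle_square_arc /=; lia.
Qed.

End CappedCycleSquare.

Theorem theorem4 (n : nat) (hn : 7 <= n) :
  (forall (T : finType) (e : rel T),
      symmetric e -> irreflexive e -> #|T| = n ->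
      gconnected e -> gsize e <= 2 * n ->
      exists S : {set T}, foresty_min_vertex_cut e S)
  /\
  (exists e : rel 'I_n,
      [/\ symmetric e, irreflexive e, gconnected e, gsize e = 2 * n + 1 &
          ~ (exists S : {set 'I_n}, foresty_min_vertex_cut e S)]).
Proof.
split=> [T e e_sym e_irr Tn _ sz|].
  by apply: foresty_min_vertex_cut_exists; rewrite ?Tn.
case: n hn => // N N6; exists (fun x y => capped_cycle_square N x y); split.
- exact: capped_sym.
- exact: capped_irr.
- exact: capped_connected.
- exact: capped_size.
- by case=> S; apply: capped_no_foresty.
Qed.
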